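(* Let $\mathsf{C}$ be a quasi-Markov category such that: (1) $\mathsf{C}$ is positive and $\sigma$-continuous; (2) countable Kolmogorov products exist in $\mathsf{C}$; (3) all balanced idempotents in $\mathsf{C}$ split; (4) every object $X$ of $\mathsf{C}$ has an empirical sampling morphism $\mathsf{es}: X^{\mathbb{N}} \to X$. Let $f:A\to X^{\mathbb{N}}$ be an arbitrary exchangeable morphism and $p:A\to X$ an arbitrary morphism in $\mathsf{C}$. Then $$(\mathsf{es}^\sharp\otimes \mathrm{id}_{X^{\mathbb{N}}})\,\mathrm{copy}_{X^{\mathbb{N}}}\, f=(\mathrm{id}_{PX}\otimes \mathsf{samp}^{(\mathbb{N})})\,\mathrm{copy}_{PX}\,\mathsf{es}^\sharp f$$ and $$(\mathsf{es}^\sharp\otimes \mathrm{id}_{X^{\mathbb{N}}})\,\mathrm{copy}_{X^{\mathbb{N}}}\, p^{(\mathbb{N})}=(p^\sharp\otimes p^{(\mathbb{N})})\,\mathrm{copy}_{A}.$$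
   Context: Notation: $\mathbb{N}=\{1,2,3,\ldots\}$; composition is written by juxtaposition; coherence isomorphisms are suppressed. A CD category is a symmetric monoidal category $(\mathsf{C},\otimes,I)$ in which every object $X$ carries a distinguished commutative comonoid structure $\mathrm{copy}_X:X\to X\otimes X$, $\mathrm{del}_X:X\to I$, compatible with the tensor product (these are not required to be natural). A morphism $f:A\to X$ is total if $\mathrm{del}_X f=\mathrm{del}_A$; quasi-total if $f=(f\otimes \mathrm{del}_X f)\,\mathrm{copy}_A$; copyable if $\mathrm{copy}_X f=(f\otimes f)\,\mathrm{copy}_A$; deterministic if total and copyable. A quasi-Markov category is a CD category in which every morphism is quasi-total. $\mathsf{C}_{\rm cop}$ is the wide subcategory of copyable morphisms. $\mathsf{C}$ is positive if for all $f:X\to Y$, $g:Y\to Z$ with $gf$ copyable one has $(\mathrm{id}_Y\otimes g)\,\mathrm{copy}_Y f=(f\otimes gf)\,\mathrm{copy}_X$. The domain of $f:A\to X$ is $\mathrm{dom}(f)=(\mathrm{id}_A\otimes \mathrm{del}_X f)\,\mathrm{copy}_A:A\to A$. For $f,g:A\to X$, write $f\sqsupseteq g$ ($f$ extends $g$) if $f\,\mathrm{dom}(g)=g$; this is a partial order on hom-sets. A positive quasi-Markov category is $\sigma$-continuous if, with respect to $\sqsupseteq$, every descending sequence $f_1\sqsupseteq f_2\sqsupseteq\cdots$ of morphisms $X\to Y$ has a meet (greatest lower bound) $\bigwedge_n f_n$, and these meets are preserved by pre- and post-composition and by tensoring with arbitrary morphisms. A Kolmogorov product $\bigotimes_{i\in\mathbb{N}}X_i$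 of a sequence of objects is a limit in $\mathsf{C}$ of the diagram $\cdots\to X_1\otimes\cdots\otimes X_n\to\cdots\to X_1\otimes X_2\to X_1$ (arrows delete the last factor) whose cone components $\pi_n:\bigotimes_{i\in\mathbb{N}} X_i\to X_1\otimes\cdots\otimes X_n$ are deterministic and which is preserved by $-\otimes Y$ for every object $Y$. $X^{\mathbb{N}}$ denotes the Kolmogorov power (all $X_i=X$). For $f:A\to X$, $f^{(n)}:A\to X^{\otimes n}$ is the $n$-fold copy of $A$ followed by $f^{\otimes n}$, and $f^{(\mathbb{N})}:A\to X^{\mathbb{N}}$ is the unique morphism with $\pi_n f^{(\mathbb{N})}=f^{(n)}$ for all $n$. For a finite permutation $\sigma$ of $\mathbb{N}$ (a bijection fixing all but finitely many elements), $X^\sigma:X^{\mathbb{N}}\to X^{\mathbb{N}}$ is the induced deterministic morphism permuting the factors (its $i$-th output is its $\sigma(i)$-th input). A morphism $f:A\to X^{\mathbb{N}}\otimes Y$ is exchangeable in the first factor if $(X^\sigma\otimes \mathrm{id}_Y)f=f$ for every finite permutation $\sigma$; for $Y=I$ one says $f$ is exchangeable. An empirical sampling morphism for $X$ is a morphism $\mathsf{es}:X^{\mathbb{N}}\to X$ such that (i) $\mathsf{es}\,X^\sigma=\mathsf{es}$ for every finite permutation $\sigma$ of $\mathbb{N}$, and (ii) for all objects $A,Y$ and every $f:A\to X^{\mathbb{N}}\otimes Y$ exchangeable in the first factor, $(\mathsf{es}^{(\mathbb{N})}\otimes\mathrm{id}_Y)f=f$. An idempotent $e:X\to X$ is balanced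 if $(\mathrm{id}_X\otimes e)\,\mathrm{copy}_X e=(e\otimes \mathrm{id}_X)\,\mathrm{copy}_X e$. It splits if there are $\pi:X\to E$, $\iota:E\to X$ with $e=\iota\pi$ and $\pi\iota=\mathrm{id}_E$. A distribution object for $X$ is an object $PX$ with bijections $\mathsf{C}(A,X)\cong\mathsf{C}_{\rm cop}(A,PX)$, $f\mapsto f^\sharp$, natural in $A\in\mathsf{C}_{\rm cop}$; the sampling morphism $\mathsf{samp}:PX\to X$ is the counterpart of $\mathrm{id}_{PX}$, so that $f=\mathsf{samp}\,f^\sharp$. Under hypotheses (1)--(4), every object has a distribution object (indeed $\mathsf{C}$ is observationally representable: for every $X$ the family $(\mathsf{samp}^{(n)}:PX\to X^{\otimes n})_{n\in\mathbb{N}}$ is jointly monic), and $PX$, $\mathsf{samp}$, $(-)^\sharp$ refer to these; $\mathsf{es}^\sharp:X^{\mathbb{N}}\to PX$ is the counterpart of $\mathsf{es}$. *)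

(* Defs.v *)
From mathcomp Require Import all_boot.

Set Implicit Arguments.
Unset Strict Implicit.
Unset Printing Implicit Defensive.

Declare Scope cat_scope.
Delimit Scope cat_scope with cat.
Local Open Scope cat_scope.

Reserved Notation "A ~> B" (at level 70, no associativity).
Reserved Notation "g ∘ f" (at level 40, left associativity).
Reserved Notation "A ⊗ B" (at level 38, left associativity).
Reserved Notation "f ⊠ g" (at level 38, left associativity).

(* Monoidal categories are not assumed strict, so the coherence isomorphisms
   appear explicitly. *)
Record symMonCat := SymMonCat {
  ob :> Type;
  hom : ob -> ob -> Type where "A ~> B" := (hom A B);
  idm : forall A, A ~> A;
  comp : forall A B D, B ~> D -> A ~> B -> A ~> D
    where "g ∘ f" := (comp g f);
  comp_idl : forall A B (f : A ~> B), idm B ∘ f = f;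
  comp_idr : forall A B (f : A ~> B), f ∘ idm A = f;
  compA : forall A B D E (h : D ~> E) (g : B ~> D) (f : A ~> B),
    h ∘ (g ∘ f) = (h ∘ g) ∘ f;

  tens : ob -> ob -> ob where "A ⊗ B" := (tens A B);
  unit_ob : ob;
  tensm : forall A B A' B', A ~> A' -> B ~> B' -> A ⊗ B ~> A' ⊗ B'
    where "f ⊠ g" := (tensm f g);
  tensm_id : forall A B, idm A ⊠ idm B = idm (A ⊗ B);
  tensm_comp : forall A B A' B' A'' B'' (f' : A' ~> A'') (g' : B' ~> B'')
      (f : A ~> A') (g : B ~> B'),
    (f' ∘ f) ⊠ (g' ∘ g) = (f' ⊠ g') ∘ (f ⊠ g);

  assoc : forall A B D, (A ⊗ B) ⊗ D ~> A ⊗ (B ⊗ D);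
  associ : forall A B D, A ⊗ (B ⊗ D) ~> (A ⊗ B) ⊗ D;
  lunit : forall A, unit_ob ⊗ A ~> A;
  luniti : forall A, A ~> unit_ob ⊗ A;
  runit : forall A, A ⊗ unit_ob ~> A;
  runiti : forall A, A ~> A ⊗ unit_ob;
  braid : forall A B, A ⊗ B ~> B ⊗ A;

  assocK : forall A B D, associ A B D ∘ assoc A B D = idm _;
  associK : forall A B D, assoc A B D ∘ associ A B D = idm _;
  lunitK : forall A, luniti A ∘ lunit A = idm _;
  lunitiK : forall A, lunit A ∘ luniti A = idm _;
  runitK : forall A, runiti A ∘ runit A = idm _;
  runitiK : forall A, runit A ∘ runiti A = idm _;
  braidK : forall A B, braid B A ∘ braid A B = idm _;

  assoc_nat : forall A B D A' B' D' (f : A ~> A') (g : B ~> B') (h : D ~> D'),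
    assoc A' B' D' ∘ ((f ⊠ g) ⊠ h) = (f ⊠ (g ⊠ h)) ∘ assoc A B D;
  lunit_nat : forall A B (f : A ~> B),
    lunit B ∘ (idm unit_ob ⊠ f) = f ∘ lunit A;
  runit_nat : forall A B (f : A ~> B),
    runit B ∘ (f ⊠ idm unit_ob) = f ∘ runit A;
  braid_nat : forall A B A' B' (f : A ~> A') (g : B ~> B'),
    braid A' B' ∘ (f ⊠ g) = (g ⊠ f) ∘ braid A B;

  triangle : forall A B,
    (idm A ⊠ lunit B) ∘ assoc A unit_ob B = runit A ⊠ idm B;
  pentagon : forall A B D E,
    assoc A B (D ⊗ E) ∘ assoc (A ⊗ B) D E =
    (idm A ⊠ assoc B D E) ∘ assoc A (B ⊗ D) E ∘ (assoc A B D ⊠ idm E);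
  hexagon : forall A B D,
    assoc B D A ∘ braid A (B ⊗ D) ∘ assoc A B D =
    (idm B ⊠ braid A D) ∘ assoc B A D ∘ (braid A B ⊠ idm D)
}.

Arguments hom {s} A B.
Arguments idm {s} A.
Arguments comp {s A B D} g f.
Arguments tens {s} A B.
Arguments unit_ob {s}.
Arguments tensm {s A B A' B'} f g.
Arguments assoc {s} A B D.
Arguments associ {s} A B D.
Arguments lunit {s} A.
Arguments luniti {s} A.
Arguments runit {s} A.
Arguments runiti {s} A.
Arguments braid {s} A B.

Notation "A ~> B" := (hom A B) : cat_scope.
Notation "g ∘ f" := (comp g f) : cat_scope.
Notation "A ⊗ B" := (tens A B) : cat_scope.
Notation "f ⊠ g" := (tensm f g) : cat_scope.

(* (A ⊗ A) ⊗ (B ⊗ B) ~> (A ⊗ B) ⊗ (A ⊗ B), exchanging the middle factors *)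
Definition middle_swap (C : symMonCat) (A B : C) :
    (A ⊗ A) ⊗ (B ⊗ B) ~> (A ⊗ B) ⊗ (A ⊗ B) :=
  associ A B (A ⊗ B)
  ∘ (idm A ⊠ (assoc B A B ∘ (braid A B ⊠ idm B) ∘ associ A B B))
  ∘ assoc A A (B ⊗ B).

(* The last two axioms are the nullary part of compatibility with the tensor
   product. *)
Record cdCat := CDCat {
  cd_base :> symMonCat;
  copy : forall X : cd_base, X ~> X ⊗ X;
  del : forall X : cd_base, X ~> unit_ob;
  copyA : forall X,
    assoc X X X ∘ (copy X ⊠ idm X) ∘ copy X = (idm X ⊠ copy X) ∘ copy X;
  copyC : forall X, braid X X ∘ copy X = copy X;
  copy_dell : forall X, lunit X ∘ (del X ⊠ idm X) ∘ copy X = idm X;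
  copy_delr : forall X, runit X ∘ (idm X ⊠ del X) ∘ copy X = idm X;
  copy_tens : forall X Y,
    copy (X ⊗ Y) = middle_swap X Y ∘ (copy X ⊠ copy Y);
  del_tens : forall X Y, del (X ⊗ Y) = lunit unit_ob ∘ (del X ⊠ del Y);
  copy_unit : copy unit_ob = luniti unit_ob;
  del_unit : del unit_ob = idm unit_ob
}.

Arguments copy {c} X.
Arguments del {c} X.

Section CD.
Variable C : cdCat.
Implicit Types A X Y : C.

Definition total A X (f : A ~> X) : Prop := del X ∘ f = del A.

Definition quasi_total A X (f : A ~> X) : Prop :=
  f = runit X ∘ (f ⊠ (del X ∘ f)) ∘ copy A.

Definition copyable A X (f : A ~> X) : Prop :=
  copy X ∘ f = (f ⊠ f) ∘ copy A.

Definition deterministic A X (f : A ~> X) : Prop := total f /\ copyable f.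

Definition positive : Prop :=
  forall (X Y Z : C) (f : X ~> Y) (g : Y ~> Z), copyable (g ∘ f) ->
    (idm Y ⊠ g) ∘ copy Y ∘ f = (f ⊠ (g ∘ f)) ∘ copy X.

Definition dom A X (f : A ~> X) : A ~> A :=
  runit A ∘ (idm A ⊠ (del X ∘ f)) ∘ copy A.

Definition extends A X (f g : A ~> X) : Prop := f ∘ dom g = g.

Definition descending X Y (f : nat -> X ~> Y) : Prop :=
  forall n, extends (f n) (f n.+1).

(* [extends f g] reads "g is below f". *)
Definition is_meet X Y (f : nat -> X ~> Y) (m : X ~> Y) : Prop :=
  (forall n, extends (f n) m) /\
  (forall g, (forall n, extends (f n) g) -> extends m g).

Record sigma_continuous : Prop := SigmaContinuous {
  meet_exists : forall X Y (f : nat -> X ~> Y),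
    descending f -> exists m, is_meet f m;
  meet_precomp : forall W X Y (f : nat -> X ~> Y) m (h : W ~> X),
    descending f -> is_meet f m -> is_meet (fun n => f n ∘ h) (m ∘ h);
  meet_postcomp : forall X Y Z (f : nat -> X ~> Y) m (h : Y ~> Z),
    descending f -> is_meet f m -> is_meet (fun n => h ∘ f n) (h ∘ m);
  meet_tensl : forall W Z X Y (f : nat -> X ~> Y) m (h : W ~> Z),
    descending f -> is_meet f m -> is_meet (fun n => h ⊠ f n) (h ⊠ m);
  meet_tensr : forall W Z X Y (f : nat -> X ~> Y) m (h : W ~> Z),
    descending f -> is_meet f m -> is_meet (fun n => f n ⊠ h) (m ⊠ h)
}.

Definition balanced X (e : X ~> X) : Prop :=
  (idm X ⊠ e) ∘ copy X ∘ e = (e ⊠ idm X) ∘ copy X ∘ e.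

Definition splits X (e : X ~> X) : Prop :=
  exists (E : C) (p : X ~> E) (i : E ~> X), e = i ∘ p /\ p ∘ i = idm E.

Definition balanced_idempotents_split : Prop :=
  forall X (e : X ~> X), e ∘ e = e -> balanced e -> splits e.

(* [sharp] is a natural bijection from C(A, X) onto the copyable morphisms
   from A to PX. *)
Record distribution_object X := DistributionObject {
  dist_ob : C;
  sharp : forall A, A ~> X -> A ~> dist_ob;
  sharp_copyable : forall A (f : A ~> X), copyable (sharp f);
  sharp_inj : forall A, injective (@sharp A);
  sharp_surj : forall A (g : A ~> dist_ob),
    copyable g -> exists f, sharp f = g;
  sharp_nat : forall A B (f : A ~> X) (h : B ~> A),
    copyable h -> sharp (f ∘ h) = sharp f ∘ h;
  samp : dist_ob ~> X;
  sharp_samp : sharp samp = idm dist_ob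
}.

(* Limits of diagrams ... -> D 2 -> D 1 -> D 0 *)
Record is_seq_limit (D : nat -> C) (d : forall n, D n.+1 ~> D n)
    (L : C) (p : forall n, L ~> D n) := IsSeqLimit {
  lim_cone : forall n, d n ∘ p n.+1 = p n;
  lim_lift : forall A (c : forall n, A ~> D n),
    (forall n, d n ∘ c n.+1 = c n) -> A ~> L;
  lim_liftE : forall A (c : forall n, A ~> D n)
    (hc : forall n, d n ∘ c n.+1 = c n) n, p n ∘ lim_lift hc = c n;
  lim_uniq : forall A (h k : A ~> L), (forall n, p n ∘ h = p n ∘ k) -> h = k
}.

(* Finite tensor products are nonempty and indexed from 0:
   [ftens X n] is X 0 ⊗ ... ⊗ X n, with n + 1 factors. *)
Fixpoint ftens (X : nat -> C) (n : nat) : C :=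
  if n is m.+1 then ftens X m ⊗ X m.+1 else X 0.

Definition drop_last (X : nat -> C) (n : nat) : ftens X n.+1 ~> ftens X n :=
  runit (ftens X n) ∘ (idm (ftens X n) ⊠ del (X n.+1)).

Definition last_factor (X : nat -> C) (n : nat) : ftens X n ~> X n :=
  match n return ftens X n ~> X n with
  | 0 => idm (X 0)
  | m.+1 => lunit (X m.+1) ∘ (del (ftens X m) ⊠ idm (X m.+1))
  end.

Record kolmogorov_product (X : nat -> C) := KolmogorovProduct {
  kob : C;
  kproj : forall n, kob ~> ftens X n;
  kproj_det : forall n, deterministic (kproj n);
  klim : is_seq_limit (drop_last X) kproj;
  klim_tens : forall Y,
    is_seq_limit (D := fun n => ftens X n ⊗ Y)
      (fun n => drop_last X n ⊠ idm Y) (fun n => kproj n ⊠ idm Y)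
}.

Definition kcoord (X : nat -> C) (K : kolmogorov_product X) (i : nat) :
    kob K ~> X i :=
  last_factor X i ∘ kproj K i.

Fixpoint tuplem (X : nat -> C) A (g : forall i, A ~> X i) (n : nat) :
    A ~> ftens X n :=
  match n return A ~> ftens X n with
  | 0 => g 0
  | m.+1 => (tuplem g m ⊠ g m.+1) ∘ copy A
  end.

Fixpoint copyn A (n : nat) : A ~> ftens (fun=> A) n :=
  match n return A ~> ftens (fun=> A) n with
  | 0 => idm A
  | m.+1 => (copyn A m ⊠ idm A) ∘ copy A
  end.

Fixpoint tpowm A X (f : A ~> X) (n : nat) :
    ftens (fun=> A) n ~> ftens (fun=> X) n :=
  match n return ftens (fun=> A) n ~> ftens (fun=> X) n with
  | 0 => f
  | m.+1 => tpowm f m ⊠ f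
  end.

Definition itern A X (f : A ~> X) (n : nat) : A ~> ftens (fun=> X) n :=
  tpowm f n ∘ copyn A n.

Lemma runit_tens (A B : C) :
  runit (A ⊗ B) = (idm A ⊠ runit B) ∘ assoc A B unit_ob.
Proof.
have faithful (D E : C) (f g : D ~> E) :
    f ⊠ idm (unit_ob : C) = g ⊠ idm unit_ob -> f = g.
  move=> fg; rewrite -[f]comp_idr -[g]comp_idr -(runitiK D) !compA.
  by rewrite -!runit_nat fg.
apply: faithful.
rewrite -[LHS]comp_idl -[RHS]comp_idl -assocK -!compA; congr (_ ∘ _).
rewrite -triangle compA -tensm_id assoc_nat -compA pentagon.
rewrite !compA -!tensm_comp comp_idl triangle -assoc_nat -compA.
by rewrite -tensm_comp comp_idl.
Qed.

Lemma iternS A X (f : A ~> X) n : itern f n.+1 = (itern f n ⊠ f) ∘ copy A.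
Proof. by rewrite /itern /= compA -tensm_comp comp_idr. Qed.

Lemma itern_cone A X (f : A ~> X) : quasi_total f ->
  forall n, drop_last (fun=> X) n ∘ itern f n.+1 = itern f n.
Proof.
move=> fq n; rewrite iternS /drop_last -!compA [(_ ⊠ del X) ∘ _]compA.
rewrite -tensm_comp comp_idl compA.
elim: n => [|n IHn]; first by rewrite /itern /= comp_idr -fq.
rewrite iternS -{1}[del X ∘ f]comp_idr tensm_comp -!compA.
rewrite [ftens _ n.+1]/= runit_tens -!compA [assoc _ _ _ ∘ _]compA.
rewrite assoc_nat -[_ ∘ assoc _ _ _ ∘ _]compA [assoc _ _ _ ∘ _]compA copyA.
rewrite !compA -!tensm_comp comp_idl comp_idr.
by rewrite -fq.
Qed.

Lemma last_factor_total (X : nat -> C) n : total (last_factor X n).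
Proof.
case: n => [|n]; first exact: comp_idr.
rewrite /total /= compA -lunit_nat -compA -tensm_comp comp_idl comp_idr.
by rewrite del_tens.
Qed.

Lemma kcoord_total (X : nat -> C) (K : kolmogorov_product X) i : total (kcoord K i).
Proof.
by rewrite /total /kcoord compA last_factor_total; case: (kproj_det K i).
Qed.

Lemma tuplem_cone (X : nat -> C) A (g : forall i, A ~> X i) :
  (forall i, total (g i)) ->
  forall n, drop_last X n ∘ tuplem g n.+1 = tuplem g n.
Proof.
move=> gt n; rewrite /= /drop_last compA -[_ ∘ _ ∘ (_ ⊠ _)]compA.
rewrite -tensm_comp comp_idl gt -{1}[tuplem g n]comp_idr -{1}[del A]comp_idl.
rewrite tensm_comp compA runit_nat -!compA [runit A ∘ _]compA copy_delr.
exact: comp_idr.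
Qed.

End CD.

Arguments drop_last {C} X n.
Arguments last_factor {C} X n.
Arguments copyn {C} A n.
Arguments sharp {C X} d {A} f.
Arguments samp {C X} d.
Arguments sigma_continuous C : clear implicits.
Arguments positive C : clear implicits.
Arguments balanced_idempotents_split C : clear implicits.

Record quasiMarkovCat := QuasiMarkovCat {
  qm_base :> cdCat;
  qm_quasi_total : forall (A X : qm_base) (f : A ~> X), quasi_total f
}.

Definition finite_permutation (s : nat -> nat) : Prop :=
  bijective s /\ exists N, forall i, N <= i -> s i = i.

Section KolmogorovPowers.
Variables (C : quasiMarkovCat).
Variable K : forall X : nat -> C, kolmogorov_product X.

Definition kpow (X : C) : C := kob (K (fun=> X)).

Definition iterN (A X : C) (f : A ~> X) : A ~> kpow X :=
  lim_lift (klim (K (fun=> X))) (itern_cone (qm_quasi_total f)).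

(* The i-th output is the (s i)-th input. *)
Definition kperm (X : C) (s : nat -> nat) : kpow X ~> kpow X :=
  lim_lift (klim (K (fun=> X)))
    (tuplem_cone (X := fun=> X) (g := fun i => kcoord (K (fun=> X)) (s i))
       (fun i => kcoord_total (K (fun=> X)) (s i))).

Definition exchangeable_fst (A X Y : C) (f : A ~> kpow X ⊗ Y) : Prop :=
  forall s, finite_permutation s -> (kperm X s ⊠ idm Y) ∘ f = f.

Definition exchangeable (A X : C) (f : A ~> kpow X) : Prop :=
  forall s, finite_permutation s -> kperm X s ∘ f = f.

Definition empirical_sampling (X : C) (es : kpow X ~> X) : Prop :=
  (forall s, finite_permutation s -> es ∘ kperm X s = es) /\
  (forall (A Y : C) (f : A ~> kpow X ⊗ Y), exchangeable_fst f ->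
     (iterN es ⊠ idm Y) ∘ f = f).

End KolmogorovPowers.

(* Main.v *)
From mathcomp Require Import all_boot.
Require Import Defs.

Set Implicit Arguments.
Unset Strict Implicit.
Unset Printing Implicit Defensive.

Local Open Scope cat_scope.

(** Write [e] for [iterN K es], the operation that takes a sequence, forms its
    empirical distribution and draws a fresh independent sequence from it. The
    theorem follows from three properties of [e].

    It fixes exchangeable morphisms (de Finetti), and independent samples
    [iterN K p] are exchangeable. In particular [e] is idempotent.

    It ignores finite permutations. So in a pair formed by [e] of a sequence
    and the sequence itself, where the sequence is exchangeable, permuting the
    second component has the same effect as permuting the sequence before
    copying it, which is none: the pair is exchangeable in its second
    component, and applying [e] there changes nothing ([resample_right]). Together with the mirror statement this makes
    [e] balanced.

    On two copies of an independent sample of [p], it gives two independent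
    samples ([resample_iterN], a law of large numbers): on finitely many
    factors this says no more than that [e] fixes [iterN K p].

    Split [e] as [iota ∘ pi] through [E]. Positivity identifies copying on [E]
    with copying in the sequence space, so the third property says that
    [pi ∘ iterN K p] is copyable, and that [E] is a distribution object with
    [sharp p = pi ∘ iterN K p] and [samp = es ∘ iota]. For this object
    [sharp es = pi] and [iterN K samp = iota], and both equations become
    instances of the second and third properties with [pi] applied to the first
    component. Distribution objects are determined up to a copyable comparison,
    which transports the equations to an arbitrary one.

    That permutations of factors are copyable comes from positivity: they are
    isomorphisms. *)

(** * Copying, pairs and tuples *)

Section CD.
Variable C : cdCat.
Implicit Types A B X Y Z : C.

Definition pairm A X Y (f : A ~> X) (g : A ~> Y) : A ~> X ⊗ Y :=
  (f ⊠ g) ∘ copy A.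

Lemma tensm_pairm A X Y X' Y' (h : X ~> X') (k : Y ~> Y')
    (f : A ~> X) (g : A ~> Y) :
  (h ⊠ k) ∘ pairm f g = pairm (h ∘ f) (k ∘ g).
Proof. by rewrite /pairm compA -tensm_comp. Qed.

Lemma tensm_pairm_comp A B X Y X' Y' (h : X ~> X') (k : Y ~> Y')
    (f : A ~> X) (g : A ~> Y) (u : B ~> A) :
  (h ⊠ k) ∘ (pairm f g ∘ u) = pairm (h ∘ f) (k ∘ g) ∘ u.
Proof. by rewrite compA tensm_pairm. Qed.

Lemma pairm_comp A B X Y (f : A ~> X) (g : A ~> Y) (h : B ~> A) :
  copyable h -> pairm f g ∘ h = pairm (f ∘ h) (g ∘ h).
Proof. by move=> hc; rewrite /pairm -compA hc compA -tensm_comp. Qed.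

Lemma copy_comp A X (f : A ~> X) : copyable f -> copy X ∘ f = pairm f f.
Proof. by []. Qed.

Lemma pairm_id A : pairm (idm A) (idm A) = copy A.
Proof. by rewrite /pairm tensm_id comp_idl. Qed.

Lemma braid_pairm A X Y (f : A ~> X) (g : A ~> Y) :
  braid X Y ∘ pairm f g = pairm g f.
Proof. by rewrite /pairm compA braid_nat -compA copyC. Qed.

Lemma assoc_pairm A X Y Z (f : A ~> X) (g : A ~> Y) (h : A ~> Z) :
  assoc X Y Z ∘ pairm (pairm f g) h = pairm f (pairm g h).
Proof.
rewrite /pairm -[h in LHS]comp_idr tensm_comp !compA assoc_nat.
rewrite -[_ ∘ assoc _ _ _ ∘ _]compA -[_ ∘ (assoc _ _ _ ∘ _) ∘ _]compA copyA.
by rewrite compA -tensm_comp comp_idr.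
Qed.

Lemma associ_pairm A X Y Z (f : A ~> X) (g : A ~> Y) (h : A ~> Z) :
  associ X Y Z ∘ pairm f (pairm g h) = pairm (pairm f g) h.
Proof. by rewrite -assoc_pairm compA assocK comp_idl. Qed.

Lemma copyable_id A : copyable (idm A).
Proof. by rewrite /copyable comp_idr tensm_id comp_idl. Qed.

(** Positivity, applied to the copyable composite [k ∘ h = idm A], turns [copy]
    after the section [h] into copying before it. *)
Lemma section_pairm A X (h : A ~> X) (k : X ~> A) : positive C ->
  k ∘ h = idm A -> pairm (idm X) k ∘ h = pairm h (idm A).
Proof.
move=> Cpos kh; have := Cpos _ _ _ h k; rewrite kh; apply.
exact: copyable_id.
Qed.

(** The comonoid structure of a retract is the one transported along the
    retraction. *)
Lemma copy_retract A X (h : A ~> X) (k : X ~> A) : positive C ->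
  k ∘ h = idm A -> copy A = pairm k k ∘ h.
Proof.
move=> Cpos kh; have := congr1 (comp (k ⊠ idm A)) (section_pairm Cpos kh).
by rewrite compA !tensm_pairm kh !comp_idl comp_idr pairm_id.
Qed.

Lemma copyable_iso A X (h : A ~> X) (k : X ~> A) : positive C ->
  k ∘ h = idm A -> h ∘ k = idm X -> copyable h.
Proof.
move=> Cpos kh hk; have := congr1 (comp (idm X ⊠ h)) (section_pairm Cpos kh).
by rewrite compA !tensm_pairm hk !comp_idl comp_idr pairm_id.
Qed.

Lemma runiti_nat A B (f : A ~> B) :
  runiti B ∘ f = (f ⊠ idm unit_ob) ∘ runiti A.
Proof.
rewrite -[f in LHS]comp_idr -(runitiK A) [f ∘ (_ ∘ _)]compA -runit_nat.
by rewrite !compA runitK comp_idl.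
Qed.

(** Copying on the unit object is an invertible unitor, so its commutativity
    forces the braiding there to be trivial. *)
Lemma braid_unit : braid unit_ob unit_ob = idm (unit_ob ⊗ unit_ob : C).
Proof.
rewrite -[LHS]comp_idr -(lunitK (unit_ob : C)) compA -(copy_unit C) copyC.
by rewrite copy_unit lunitK.
Qed.

Lemma associ_nat A B X A' B' X' (f : A ~> A') (g : B ~> B') (h : X ~> X') :
  associ A' B' X' ∘ (f ⊠ (g ⊠ h)) = ((f ⊠ g) ⊠ h) ∘ associ A B X.
Proof.
rewrite -[LHS]comp_idr -(associK A B X) compA -[_ ∘ assoc _ _ _]compA.
by rewrite -assoc_nat !compA assocK comp_idl.
Qed.

(** Discarding the two middle factors before or after exchanging them is the
    same, as the braiding is then that of the unit object. *)
Lemma del_middle_swap A B :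
  ((idm A ⊠ del B) ⊠ (del A ⊠ idm B)) ∘ middle_swap A B =
  (idm A ⊠ del A) ⊠ (del B ⊠ idm B).
Proof.
rewrite /middle_swap !compA -associ_nat -[_ ∘ _ ∘ (idm A ⊠ _)]compA.
rewrite -tensm_comp comp_idl !compA -assoc_nat -[_ ∘ _ ∘ (braid A B ⊠ _)]compA.
rewrite -tensm_comp comp_idl -braid_nat braid_unit comp_idl.
rewrite -[_ ∘ _ ∘ associ A B B]compA -associ_nat compA associK comp_idl.
by rewrite -compA -assoc_nat compA assocK comp_idl.
Qed.

(** A pair is recovered from its two components: this is what makes the finite
    projections of a Kolmogorov product tuples of coordinates. *)
Lemma pairm_proj A B :
  pairm (runit A ∘ (idm A ⊠ del B)) (lunit B ∘ (del A ⊠ idm B)) = idm (A ⊗ B).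
Proof.
rewrite -tensm_pairm /pairm copy_tens [(_ ⊠ _) ∘ (middle_swap _ _ ∘ _)]compA.
by rewrite del_middle_swap -!tensm_comp !compA copy_delr copy_dell tensm_id.
Qed.

Lemma tuplemS X A (g : nat -> A ~> X) n :
  tuplem (X := fun=> X) g n.+1 = pairm (tuplem (X := fun=> X) g n) (g n.+1).
Proof. by []. Qed.

Lemma eq_tuplem (X : nat -> C) A (g h : forall i, A ~> X i) n :
  (forall i, i <= n -> g i = h i) -> tuplem g n = tuplem h n.
Proof.
elim: n => [|n IHn] gh /=; first exact: gh.
by rewrite gh // IHn // => i le_in; apply: gh; apply: leqW.
Qed.

Lemma tuplem_comp (X : nat -> C) A B (g : forall i, A ~> X i) (h : B ~> A) n :
  copyable h -> tuplem g n ∘ h = tuplem (fun i => g i ∘ h) n.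
Proof. by move=> hc; elim: n => //= n <-; exact: pairm_comp. Qed.

Lemma itern_tuplem A X (f : A ~> X) n :
  itern f n = tuplem (X := fun=> X) (fun=> f) n.
Proof.
by elim: n => [|n IHn]; [exact: comp_idr | rewrite iternS IHn].
Qed.

Lemma itern_comp A B X (f : A ~> X) (h : B ~> A) n :
  copyable h -> itern f n ∘ h = itern (f ∘ h) n.
Proof. by move=> hc; rewrite !itern_tuplem tuplem_comp. Qed.

(** Coassociativity. The regrouping [w] does not depend on [f]: hence
    precomposing a pair of iterates of one morphism and pairing iterates of
    another can be compared on single iterates. *)
Lemma itern_pairm X m n : exists k (w : ftens (fun=> X) k ~> _),
  forall A (f : A ~> X), pairm (itern f m) (itern f n) = w ∘ itern f k.
Proof.
elim: n => [|n [k [w wE]]].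
  exists m.+1, (idm _) => A f; rewrite comp_idl iternS.
  by rewrite {2}/itern /= comp_idr.
exists k.+1, (assoc _ _ _ ∘ (w ⊠ idm X)) => A f.
by rewrite -compA !iternS -!/(pairm _ f) tensm_pairm -wE comp_idl assoc_pairm.
Qed.

(** * Reordering tuples *)

(** The reordering [w] is independent of the tuple [g]. Taking [g] constant shows
    that [w] fixes iterates; taking [g] the coordinates of a Kolmogorov power
    relates [w] to the action of [s] there. *)
Definition reorders X n (s : nat -> nat) : Prop :=
  exists w : ftens (fun=> X) n ~> ftens (fun=> X) n, forall A (g : nat -> A ~> X),
    tuplem (X := fun=> X) (g \o s) n = w ∘ tuplem (X := fun=> X) g n.

Lemma reorders_comp X n s t :
  reorders X n s -> reorders X n t -> reorders X n (s \o t).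
Proof.
move=> [v vE] [w wE]; exists (w ∘ v) => A g.
by rewrite -compA -vE -wE.
Qed.

Lemma eq_reorders X n s t : s =1 t -> reorders X n s -> reorders X n t.
Proof.
move=> st [w wE]; exists w => A g; rewrite -wE.
by apply: eq_tuplem => i _; rewrite /= st.
Qed.

Definition adjswap k i := if i == k then k.+1 else if i == k.+1 then k else i.

Lemma adjswapL k : adjswap k k = k.+1.
Proof. by rewrite /adjswap eqxx. Qed.

Lemma adjswapR k : adjswap k k.+1 = k.
Proof. by rewrite /adjswap eqxx (gtn_eqF (ltnSn k)). Qed.

Lemma adjswap_lt k i : i < k -> adjswap k i = i.
Proof. by move=> ik; rewrite /adjswap !ltn_eqF // leqW. Qed.

Lemma adjswap_gt k i : k.+1 < i -> adjswap k i = i.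
Proof. by move=> ki; rewrite /adjswap !gtn_eqF // ltnW. Qed.

Lemma adjswapK k : involutive (adjswap k).
Proof.
move=> i; case: (ltngtP i k) => [ik|ki|->]; first by rewrite !adjswap_lt.
  case: (ltngtP i k.+1) => [|ki'|->]; last by rewrite adjswapR adjswapL.
    by rewrite ltnS leqNgt ki.
  by rewrite !adjswap_gt.
by rewrite adjswapL adjswapR.
Qed.

Lemma reorders_adjswap X n k : k < n -> reorders X n (adjswap k).
Proof.
elim: n => // n IHn; rewrite ltnS leq_eqVlt => /orP[/eqP->|kn].
  case: n {IHn} => [|n].
    exists (braid X X) => A g.
    by rewrite !tuplemS braid_pairm /= adjswapL adjswapR.
  exists (associ _ X X ∘ (idm _ ⊠ braid X X) ∘ assoc _ X X) => A g.
  rewrite !tuplemS -!compA assoc_pairm tensm_pairm braid_pairm comp_idl.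
  rewrite associ_pairm /= adjswapL adjswapR; congr (pairm (pairm _ _) _).
  by apply: eq_tuplem => i ni; rewrite /= adjswap_lt.
have [w wE] := IHn kn; exists (w ⊠ idm X) => A g.
by rewrite !tuplemS tensm_pairm -wE comp_idl /= adjswap_gt.
Qed.

(** Bubble sort: adjacent swaps bring the preimage of the largest moved index
    to the top, after which fewer indices are moved. *)
Lemma reorders_perm X n N s : bijective s -> (forall i, N <= i -> s i = i) ->
  N <= n.+1 -> reorders X n s.
Proof.
elim: N s => [|N IHN] s sbij sfix leN.
  exists (idm _) => A g; rewrite comp_idl.
  by apply: eq_tuplem => i _; rewrite /= sfix.
have [r sK rK] := sbij; have sr : s (r N) = N := rK N.
have le_rN : r N <= N.
  by rewrite leqNgt; apply/negP => Nr; move: (Nr); rewrite -{1}sr sfix ?ltnn.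
(* Induction on the distance [d] from the preimage [r N] of [N] up to [N]. *)
move: sr; rewrite -(subKn le_rN); move: (N - r N) (leq_subr (r N) N) => d.
elim: d s sbij sfix {r sK rK le_rN} => [|d IHd] s sbij sfix le_dN.
  rewrite subn0 => sN; apply: IHN => //; last exact: ltnW.
  by move=> i; rewrite leq_eqVlt => /orP[/eqP<-|/sfix].
set k := N - d.+1 => sk; have kS : N - d = k.+1 by rewrite -subSn.
have le_kN : k < N by rewrite -kS leq_subr.
apply: (eq_reorders (s := (s \o adjswap k) \o adjswap k)).
  by move=> i; rewrite /= adjswapK.
apply: reorders_comp; last by apply: reorders_adjswap; apply: leq_trans le_kN _.
apply: IHd; [ | | exact: ltnW | by rewrite kS /= adjswapR].
  exact: bij_comp sbij (inv_bij (adjswapK k)).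
move=> i lt_Ni; rewrite /= adjswap_gt ?sfix //.
exact: leq_ltn_trans le_kN lt_Ni.
Qed.

(** * Kolmogorov products *)

Section Kolmogorov.
Variables (X : nat -> C) (K : kolmogorov_product X).

Lemma tuplem_kcoord n : tuplem (kcoord K) n = kproj K n.
Proof.
elim: n => [|n /= ->]; first exact: comp_idl.
rewrite -(lim_cone (klim K)) -/(pairm _ _) -pairm_comp ?pairm_proj ?comp_idl //.
by case: (kproj_det K n.+1).
Qed.

(** The cone condition recovers the first projections from later ones; a finite
    permutation acts within the first [n] factors only for large [n]. *)
Lemma kproj_faithful A (f g : A ~> kob K) N :
  (forall n, N <= n -> kproj K n ∘ f = kproj K n ∘ g) -> f = g.
Proof.
move=> fg; apply: (lim_uniq (klim K)) => n.
have {fg}: kproj K (n + N) ∘ f = kproj K (n + N) ∘ g by apply: fg; exact: leq_addl.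
elim: N => [|N IHN]; rewrite ?addn0 // addnS => fg; apply: IHN.
by rewrite -(lim_cone (klim K)) -!compA fg.
Qed.

(** The projections of [kob K ⊗ kob K] are jointly monic because the limit is
    preserved by tensoring, applied once in each factor. *)
Lemma kproj_tens_faithful A (f g : A ~> kob K ⊗ kob K) :
  (forall m n, (kproj K m ⊠ kproj K n) ∘ f = (kproj K m ⊠ kproj K n) ∘ g) ->
  f = g.
Proof.
move=> fg; apply: (lim_uniq (klim_tens K (kob K))) => m.
have swapI (h k : A ~> ftens X m ⊗ kob K) :
    braid _ _ ∘ h = braid _ _ ∘ k -> h = k.
  move=> hk; rewrite -[h]comp_idl -[k]comp_idl -(braidK (ftens X m) (kob K)).
  by rewrite -!compA hk.
apply: swapI; apply: (lim_uniq (klim_tens K (ftens X m))) => n.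
rewrite !compA -!braid_nat -!compA; congr (_ ∘ _).
by rewrite !compA -!tensm_comp !comp_idl !comp_idr.
Qed.

End Kolmogorov.

End CD.

(** * Exchangeability of iterates *)

Section Powers.
Variable C : quasiMarkovCat.
Variable K : forall X : nat -> C, kolmogorov_product X.
Implicit Types A B X Y Z : C.

Lemma kproj_iterN A X (f : A ~> X) n :
  kproj (K (fun=> X)) n ∘ iterN K f = itern f n.
Proof. exact: lim_liftE. Qed.

Lemma kproj_kperm X s n : kproj (K (fun=> X)) n ∘ kperm K X s =
  tuplem (X := fun=> X) (kcoord (K (fun=> X)) \o s) n.
Proof. exact: lim_liftE. Qed.

Lemma iterN_comp A B X (f : A ~> X) (h : B ~> A) :
  copyable h -> iterN K f ∘ h = iterN K (f ∘ h).
Proof.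
move=> hc; apply: (kproj_faithful (N := 0)) => n _.
by rewrite compA !kproj_iterN itern_comp.
Qed.

Lemma kproj0_iterN A X (f : A ~> X) : kproj (K (fun=> X)) 0 ∘ iterN K f = f.
Proof. by rewrite kproj_iterN [LHS]comp_idr. Qed.

Lemma reorders_finite_permutation X s : finite_permutation s ->
  exists N, forall n, N <= n -> reorders X n s.
Proof.
move=> [sbij [N sfix]]; exists N => n le_Nn.
exact: reorders_perm sbij sfix (leqW le_Nn).
Qed.

Lemma iterN_exchangeable A X (f : A ~> X) : exchangeable (iterN K f).
Proof.
move=> s /(reorders_finite_permutation X)[N sN].
apply: (kproj_faithful (N := N)) => n /sN[w wE].
rewrite compA kproj_kperm wE tuplem_kcoord -compA kproj_iterN.
by rewrite itern_tuplem -wE.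
Qed.

(** As [reorders] does not restrict the tuple, the inverse law needs no
    copyability of [kperm K X s], which is deduced from it. *)
Lemma kpermK X s r : finite_permutation r -> cancel r s ->
  kperm K X r ∘ kperm K X s = idm _.
Proof.
move=> /(reorders_finite_permutation X)[N rN] rK.
apply: (kproj_faithful (N := N)) => n /rN[w wE].
rewrite compA kproj_kperm wE tuplem_kcoord -compA kproj_kperm -wE comp_idr.
by rewrite -tuplem_kcoord; apply: eq_tuplem => i _; rewrite /= rK.
Qed.

Lemma kperm_copyable X s : positive C -> finite_permutation s ->
  copyable (kperm K X s).
Proof.
move=> Cpos sfin; have [[r sK rK] [N sfix]] := sfin.
have rfin : finite_permutation r.
  split; first by exists s.
  by exists N => i /sfix si; rewrite -{1}si sK.
by apply: (copyable_iso (k := kperm K X r) Cpos); apply: kpermK.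
Qed.

End Powers.

(** * Empirical sampling *)

Section EmpiricalSampling.
Variable C : quasiMarkovCat.
Hypothesis Cpos : positive C.
Variable K : forall X : nat -> C, kolmogorov_product X.
Variables (X : C) (es : kpow K X ~> X).
Hypothesis esP : empirical_sampling es.
Implicit Types A B Y Z : C.

Let e := iterN K es.

Lemma iterN_es_kperm s : finite_permutation s -> e ∘ kperm K X s = e.
Proof.
move=> sfin; rewrite /e iterN_comp; last exact: kperm_copyable.
by rewrite esP.1.
Qed.

(** The defining property of [es], with the unit object as second factor. *)
Lemma iterN_es_exchangeable A (f : A ~> kpow K X) : exchangeable f -> e ∘ f = f.
Proof.
move=> fex; have runitiI (h k : A ~> kpow K X) :
    runiti _ ∘ h = runiti _ ∘ k -> h = k.
  by move=> hk; rewrite -[h]comp_idl -[k]comp_idl -runitiK -!compA hk.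
apply: runitiI; rewrite compA runiti_nat -compA esP.2 // => s sfin.
by rewrite compA -runiti_nat -compA fex.
Qed.

Lemma iterN_es_iterN A (f : A ~> X) : e ∘ iterN K f = iterN K f.
Proof. exact: iterN_es_exchangeable (iterN_exchangeable K f). Qed.

Lemma es_iterN A (f : A ~> X) : es ∘ iterN K f = f.
Proof.
by rewrite -{1}(kproj0_iterN K es) -compA iterN_es_iterN kproj0_iterN.
Qed.

(** Permuting only the second copy of [f] amounts to permuting both, since [e]
    ignores permutations of the first, and hence to permuting [f]. So the pair is
    exchangeable in the second copy, which may be replaced by a resampled one. *)
Lemma resample_right A (f : A ~> kpow K X) : exchangeable f ->
  pairm e (idm _) ∘ f = pairm e e ∘ f.
Proof.
move=> fex; set h := pairm e _ ∘ f.
have hex s : finite_permutation s -> (idm _ ⊠ kperm K X s) ∘ h = h.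
  move=> sfin; rewrite /h compA tensm_pairm comp_idl comp_idr.
  rewrite -{1}(iterN_es_kperm sfin) -{2}[kperm _ _ _]comp_idl.
  rewrite -(pairm_comp _ _ (kperm_copyable K X Cpos sfin)) -compA.
  by rewrite fex.
have braidI (k k' : A ~> kpow K X ⊗ kpow K X) :
    braid _ _ ∘ k = braid _ _ ∘ k' -> k = k'.
  by move=> kk; rewrite -[k]comp_idl -[k']comp_idl -braidK -!compA kk.
have: (idm _ ⊠ e) ∘ h = h.
  apply: braidI; rewrite compA braid_nat -compA esP.2 // => s sfin.
  by rewrite compA -braid_nat -compA hex.
by rewrite {1}/h compA tensm_pairm comp_idl comp_idr => <-.
Qed.

Lemma resample_left A (f : A ~> kpow K X) : exchangeable f ->
  pairm (idm _) e ∘ f = pairm e e ∘ f.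
Proof.
by move=> fex; rewrite -braid_pairm -compA resample_right // compA braid_pairm.
Qed.

Lemma iterN_es_idem : e ∘ e = e.
Proof. exact: iterN_es_iterN. Qed.

Lemma iterN_es_balanced : balanced e.
Proof.
have eex := iterN_exchangeable K es.
by rewrite /balanced; have := resample_left eex; rewrite -(resample_right eex).
Qed.

(** Law of large numbers: [e] applied to two copies of one independent sample
    of [f] is a pair of independent samples. Projecting to finitely many
    factors, both sides are regroupings of one finite iterate of [f], because
    [e] fixes [iterN K f]. *)
Lemma resample_iterN A (f : A ~> X) :
  pairm e e ∘ iterN K f = pairm (iterN K f) (iterN K f).
Proof.
apply: kproj_tens_faithful => m n; have [k [w wE]] := itern_pairm X m n.
rewrite compA !tensm_pairm !kproj_iterN !wE -compA -(kproj_iterN K es).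
by rewrite -compA iterN_es_iterN kproj_iterN.
Qed.

(** * The distribution object *)

Variables (E : C) (pi : kpow K X ~> E) (iota : E ~> kpow K X).
Hypotheses (eE : e = iota ∘ pi) (piK : pi ∘ iota = idm E).

Lemma pi_e : pi ∘ e = pi.
Proof. by rewrite eE compA piK comp_idl. Qed.

Lemma e_iota : e ∘ iota = iota.
Proof. by rewrite eE -compA piK comp_idr. Qed.

Lemma copyE_iota : copy E = pairm pi pi ∘ iota.
Proof. exact: copy_retract Cpos piK. Qed.

(** The law of large numbers makes the empirical distribution of an independent
    sample a copyable function of the parameter. *)
Lemma pi_iterN_copyable A (f : A ~> X) : copyable (pi ∘ iterN K f).
Proof.
rewrite /copyable copyE_iota -(compA (pairm _ _)) [iota ∘ _]compA -eE.
rewrite iterN_es_iterN.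
have -> : pairm pi pi = (pi ⊠ pi) ∘ pairm e e by rewrite tensm_pairm pi_e.
by rewrite -compA resample_iterN tensm_pairm.
Qed.

(** Sampling from the splitting object repeatedly recovers [iota]: the copies of
    a point of [E] are the [pi]-images of copies of the sequence [iota] gives,
    and [es] does not see the difference between a sequence and its [e]-image. *)
Lemma iterN_samp : iterN K (es ∘ iota) = iota.
Proof.
apply: (kproj_faithful (N := 0)) => n _; rewrite kproj_iterN.
have es_e : es ∘ e = es by rewrite es_iterN.
have projE k : kproj (K (fun=> X)) k ∘ iota = itern es k ∘ iota.
  by rewrite -{1}e_iota compA kproj_iterN.
have absorb k : itern es k ∘ iota ∘ pi = itern es k.
  by rewrite -compA -eE -(kproj_iterN K es) -compA iterN_es_idem.
rewrite projE; elim: n => [|n IHn]; first by rewrite /itern /= !comp_idr.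
rewrite !iternS IHn copyE_iota compA tensm_pairm absorb.
by rewrite -[es ∘ _ ∘ _]compA -eE es_e.
Qed.

Lemma es_iota_pi_iterN A (f : A ~> X) : es ∘ iota ∘ (pi ∘ iterN K f) = f.
Proof. by rewrite compA -[es ∘ _ ∘ _]compA -eE -compA iterN_es_iterN es_iterN. Qed.

(** Parameters are the possible values of the empirical distribution: [f] is
    sent to the empirical distribution of an independent sample of [f]. *)
Definition split_distribution : distribution_object X.
Proof.
refine (@DistributionObject C X E (fun A f => pi ∘ iterN K f)
  pi_iterN_copyable _ _ _ (es ∘ iota) _).
- by move=> A f g fg; rewrite -(es_iota_pi_iterN f) fg es_iota_pi_iterN.
- move=> A g gc; exists (es ∘ iota ∘ g).
  by rewrite -iterN_comp // iterN_samp compA piK comp_idl.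
- by move=> A B f h hc; rewrite -compA iterN_comp.
- by rewrite iterN_samp.
Defined.

(** The first equation for the splitting object, up to writing [e] as
    [iota ∘ pi] and [iota] as [iterN K (es ∘ iota)]. *)
Lemma pairm_pi_exchangeable A (f : A ~> kpow K X) : exchangeable f ->
  pairm pi (idm _) ∘ f = pairm pi e ∘ f.
Proof.
move=> fex; have := congr1 (comp (pi ⊠ idm _)) (resample_right fex).
by rewrite !tensm_pairm_comp pi_e !comp_idl.
Qed.

(** The second equation for the splitting object. *)
Lemma pairm_pi_iterN A (p : A ~> X) :
  pairm pi (idm _) ∘ iterN K p = pairm (pi ∘ iterN K p) (iterN K p).
Proof.
rewrite pairm_pi_exchangeable; last exact: iterN_exchangeable.
have := congr1 (comp (pi ⊠ idm _)) (resample_iterN p).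
by rewrite tensm_pairm_comp tensm_pairm pi_e !comp_idl.
Qed.

End EmpiricalSampling.

(** * Uniqueness of distribution objects *)

Section Comparison.
Variables (C : cdCat) (X : C).

Lemma samp_sharp (P : distribution_object X) A (f : A ~> X) :
  samp P ∘ sharp P f = f.
Proof.
apply: (@sharp_inj _ _ P); rewrite sharp_nat; last exact: sharp_copyable.
by rewrite sharp_samp comp_idl.
Qed.

Lemma sharp_comparison (P Q : distribution_object X) A (f : A ~> X) :
  sharp P f = sharp P (samp Q) ∘ sharp Q f.
Proof. by rewrite -sharp_nat ?samp_sharp //; apply: sharp_copyable. Qed.

End Comparison.

(** * Exchangeable sequences and their empirical distribution *)

Theorem theorem4p7 (C : quasiMarkovCat)
    (Cpos : positive C) (Ccont : sigma_continuous C)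
    (K : forall X : nat -> C, kolmogorov_product X)
    (Csplit : balanced_idempotents_split C)
    (es : forall X : C, kpow K X ~> X)
    (esP : forall X : C, empirical_sampling (es X))
    (X : C) :
  inhabited (distribution_object X) /\
  forall (P : distribution_object X) (A : C),
    (forall f : A ~> kpow K X, exchangeable f ->
       (sharp P (es X) ⊠ idm (kpow K X)) ∘ copy (kpow K X) ∘ f =
       (idm (dist_ob P) ⊠ iterN K (samp P)) ∘ copy (dist_ob P)
         ∘ sharp P (es X) ∘ f) /\
    (forall p : A ~> X,
       (sharp P (es X) ⊠ idm (kpow K X)) ∘ copy (kpow K X) ∘ iterN K p =
       (sharp P p ⊠ iterN K p) ∘ copy A).
Proof.
have [E [pi [iota [eE piK]]]] := Csplit _ _ (iterN_es_idem (esP X))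
  (iterN_es_balanced Cpos (esP X)).
pose Q := split_distribution Cpos (esP X) eE piK.
split=> [|P A]; first exact: (inhabits Q).
pose u := sharp P (samp Q).
have sharpPE B (f : B ~> X) : sharp P f = u ∘ (pi ∘ iterN K f).
  exact: (sharp_comparison P Q).
have sharp_es : sharp P (es X) = u ∘ pi by rewrite sharpPE (pi_e eE piK).
have upi_id (B : C) (f : B ~> kpow K X) :
    (sharp P (es X) ⊠ idm _) ∘ copy (kpow K X) ∘ f =
    (u ⊠ idm _) ∘ (pairm pi (idm _) ∘ f).
  by rewrite compA tensm_pairm comp_idl sharp_es.
split=> [f fex|p]; rewrite upi_id.
  rewrite (pairm_pi_exchangeable Cpos (esP X) eE piK fex) compA tensm_pairm.
  rewrite comp_idl -[_ ∘ copy _ ∘ _]compA copy_comp; last exact: sharp_copyable.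
  rewrite tensm_pairm comp_idl sharp_es compA iterN_comp ?samp_sharp; last first.
    exact: sharp_copyable.
  by rewrite (iterN_samp Cpos (esP X) eE piK) -eE.
by rewrite (pairm_pi_iterN Cpos (esP X) eE piK) tensm_pairm comp_idl -sharpPE.
Qed.
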